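(* Fix a first-order signature $\sigma$, a theory $T$, integers $1\le i\le n$, and a finite semiring $S$. Let $j\colon B\hookrightarrow\mathcal{P}(\mathrm{Fin}_n)$ be a Boolean algebra embedding, $X$ the Stone dual space of $B$, and $f\colon\beta(\mathrm{Fin}_n)\to X$ the continuous map dual to $j$. Let $B^i_{\exists_S}$ be the Boolean subalgebra of $\mathcal{P}(\mathrm{Fin}_{n\setminus i})$ generated by the sets \[\{(A,\alpha)\in\mathrm{Fin}_{n\setminus i}\mid \underbrace{1+\cdots+1}_{m_{\phi,(A,\alpha)}\text{ times}}=k \text{ in } S\},\qquad \phi\in B,\ k\in S,\] where $m_{\phi,(A,\alpha)}$ is the number of elements $a\in A$ such that $(A,\alpha\cup\{v_i\mapsto a\})\in j(\phi)$. Consider the composite \[\mathrm{Fin}_{n\setminus i}\xrightarrow{(A,\alpha)\mapsto \mathbb{1}^i_{(A,\alpha)}}\mathcal{S}(\mathrm{Fin}_n)\xrightarrow{g\mapsto\int g}\mathcal{M}(\beta(\mathrm{Fin}_n),S)\xrightarrow{f_*}\mathcal{M}(X,S),\] and let $R\colon\beta(\mathrm{Fin}_{n\setminus i})\to\mathcal{M}(X,S)$ be its unique continuous extension. Then the image of $R$ is homeomorphic to the Stone dual space of $B^i_{\exists_S}$.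
   Context: $\mathrm{Mod}_n$ is the set of pairs $(A,\alpha)$ with $A$ a $\sigma$-structure satisfying $T$ and $\alpha\colon\{v_1,\dots,v_n\}\to A$, two pairs being identified iff they satisfy the same first-order formulas with free variables among $v_1,\dots,v_n$; $\mathrm{Fin}_n\subseteq\mathrm{Mod}_n$ consists of those with $A$ finite. $\mathrm{Fin}_{n\setminus i}$ is defined likewise using the variables $v_1,\dots,v_n$ other than $v_i$. A semiring $(S,+,\cdot,0,1)$ has $(S,+,0)$ a commutative monoid, $(S,\cdot,1)$ a monoid, $\cdot$ distributing over $+$, and $0$ absorbing. For a set $T'$, $\beta(T')$ is the Čech–Stone compactification of the discrete set $T'$, i.e. the Stone dual of $\mathcal{P}(T')$ (its clopens correspond to subsets of $T'$). For a Boolean space $Y$ with dual algebra $C$, $\mathcal{M}(Y,S)$ is the set of maps $\mu\colon C\to S$ with $\mu(0)=0$ and $\mu(a\vee b)+\mu(a\wedge b)=\mu(a)+\mu(b)$ for all $a,b\in C$, with the subspace topology from the product topology on $S^C$ ($S$ discrete); it is a Boolean space. $\mathcal{S}(\mathrm{Fin}_n)$ is the set of finitely supported functions $\mathrm{Fin}_n\to S$. For $(A,\alpha)\in\mathrm{Fin}_{n\setminus i}$, $\mathbb{1}^i_{(A,\alpha)}\colon\mathrm{Fin}_n\to S$ takes value $1$ at $(A',\alpha')$ if $A'=A$ and $\alpha'$ agrees with $\alpha$ on all $v_l$, $l\ne i$, and $0$ otherwise. For finitely supported $g$, $\int g$ is the measure $P\mapsto\sum_{x\in P}g(x)$ for $P\subseteq\mathrm{Fin}_n$.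 For $\mu\in\mathcal{M}(\beta(\mathrm{Fin}_n),S)$, the pushforward is $f_*(\mu)(a)=\mu(f^{-1}(\widehat{a}))$ for $a\in B$, where $\widehat a$ is the clopen of $X$ corresponding to $a$.
   Formalization: The value of 1^i_(A,α) at a class in Fin_n is taken to be 1 added once for each a∈A with (A,α∪{v_i↦a}) in that class; with value 1 once per class the claim fails (empty signature, nonempty sets, n=1, S=Z/2, B={0,1}). *)

(* Defs.v *)
From HB Require Import structures.
From mathcomp Require Import all_boot all_order all_algebra finmap.
From mathcomp Require Import all_classical topology.

Set Implicit Arguments.
Unset Strict Implicit.
Unset Printing Implicit Defensive.

Import Order.Theory GRing.Theory.

Local Open Scope classical_set_scope.
Local Open Scope ring_scope.
Local Open Scope quotient_scope.

Record signature := Signature {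
  fsym : Type; farity : fsym -> nat;
  rsym : Type; rarity : rsym -> nat }.

Inductive term (s : signature) (V : Type) : Type :=
| Var of V
| App (f : fsym s) of ('I_(farity f) -> term s V).

(* [formula s V] is the type of formulas whose free variables are among [V];
   the variable bound by [All] is the element [None] of [option V]. *)
Inductive formula (s : signature) (V : Type) : Type :=
| Bot
| Eq of term s V & term s V
| Rel (r : rsym s) of ('I_(rarity r) -> term s V)
| Imp of formula s V & formula s V
| All of formula s (option V).

Definition theory (s : signature) := set (formula s void).

(* The empty carrier is allowed; adding the sentence [exists x, x = x] to the
   theory yields the convention that carriers are nonempty. *)
Record structure (s : signature) (A : Type) := Structure {
  fint : forall f : fsym s, ('I_(farity f) -> A) -> A;
  rint : forall r : rsym s, ('I_(rarity r) -> A) -> Prop }.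

Fixpoint eval s A (M : structure s A) V (al : V -> A) (t : term s V) : A :=
  match t with
  | Var v => al v
  | App f ts => fint M (fun l => eval M al (ts l))
  end.

Fixpoint sat s A (M : structure s A) V (al : V -> A) (phi : formula s V) :
    Prop :=
  match phi with
  | Bot => False
  | Eq t u => eval M al t = eval M al u
  | Rel r ts => rint M (fun l => eval M al (ts l))
  | Imp phi psi => sat M al phi -> sat M al psi
  | All phi => forall a : A,
      sat M (fun o : option V => if o is Some v then al v else a) phi
  end.

Record fin_model (s : signature) (T : theory s) := FinModel {
  carrier :> Type;
  carrier_finite : finite_set [set: carrier];
  str : structure s carrier;
  modelP : forall phi, T phi -> sat str (of_void carrier) phi }.

Record fin_pair (s : signature) (T : theory s) (V : Type) := FinPair {
  dom : fin_model T;
  asg : V -> dom }.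
Arguments FinPair {s T V}.

Section Fin.
Context (s : signature) (T : theory s) (V : Type).

Definition elem_equiv (p q : {classic (fin_pair T V)}) : bool :=
  `[< forall phi : formula s V,
        sat (str (dom p)) (@asg _ _ _ p) phi <->
        sat (str (dom q)) (@asg _ _ _ q) phi >].

Lemma elem_equiv_refl : reflexive elem_equiv.
Proof. by move=> p; apply/asboolP. Qed.

Lemma elem_equiv_sym : symmetric elem_equiv.
Proof.
by move=> p q; apply/asboolP/asboolP => pq phi; split=> /pq.
Qed.

Lemma elem_equiv_trans : transitive elem_equiv.
Proof.
move=> q p r /asboolP pq /asboolP qr; apply/asboolP => phi.
by split=> [/pq/qr|/qr/pq].
Qed.

Canonical elem_equiv_rel :=
  EquivRel elem_equiv elem_equiv_refl elem_equiv_sym elem_equiv_trans.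

Definition Fin : choiceType := {eq_quot elem_equiv_rel}.

Definition cls (p : fin_pair T V) : Fin := \pi_{eq_quot elem_equiv_rel} p.

End Fin.

(* The variables [v_1, ..., v_n] are the elements of ['I_n]. *)
Definition others n (i : 'I_n) : Type := {l : 'I_n | l != i}.

Section ExtendDrop.
Context (s : signature) (T : theory s) (n : nat) (i : 'I_n).

Definition extend (q : fin_pair T (others i)) (a : dom q) : fin_pair T 'I_n :=
  FinPair (dom q)
    (fun l => if insub l is Some l' then @asg _ _ _ q l' else a).

Definition drop_var (p : fin_pair T 'I_n) : fin_pair T (others i) :=
  FinPair (dom p) (fun l => @asg _ _ _ p (val l)).

Lemma extend_drop_var (p : fin_pair T 'I_n) :
  @extend (drop_var p) (@asg _ _ _ p i) = p.
Proof.
case: p => D al; congr FinPair; apply: funext => l /=.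
by case: insubP => [l' _ <- //|]; rewrite negbK => /eqP ->.
Qed.

Lemma drop_var_eq (p : fin_pair T 'I_n) (q : fin_pair T (others i)) :
  drop_var p = q -> exists a : dom q, p = extend a.
Proof. by move=> <-; exists (@asg _ _ _ p i); rewrite extend_drop_var. Qed.

End ExtendDrop.

Section Stone.
Context (d : Order.disp_t) (B : ctbDistrLatticeType d).

Definition is_ultrafilter (F : set B) : Prop :=
  [/\ F (\top)%O, ~ F (\bot)%O,
      (forall a b, F a -> (a <= b)%O -> F b),
      (forall a b, F a -> F b -> F (Order.meet a b)) &
      (forall a, F a \/ F (Order.compl a))].

Definition stone : Type := {F : set B | is_ultrafilter F}.

HB.instance Definition _ := gen_eqMixin stone.
HB.instance Definition _ := gen_choiceMixin stone.

Definition hat (a : B) : set stone := [set F | sval F a].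

Lemma hat_cover : \bigcup_(A in range hat) A = setT.
Proof.
apply/seteqP; split=> // F _; exists (hat (\top)%O); first by exists (\top)%O.
by rewrite /hat /=; case: (svalP F).
Qed.

Lemma hat_join (A A' : set stone) F : range hat A -> range hat A' -> A F ->
  A' F -> exists A'', [/\ range hat A'', A'' F & A'' `<=` A `&` A'].
Proof.
move=> [a _ <-] [b _ <-] Fa Fb; exists (hat (Order.meet a b)); split.
- by exists (Order.meet a b).
- by rewrite /hat /=; case: (svalP F) => _ _ _ + _; apply.
- move=> G; rewrite /hat /= => Gab; case: (svalP G) => _ _ up _ _.
  by split; apply: (up _ _ Gab); rewrite ?leIl ?leIr.
Qed.

HB.instance Definition _ := isBaseTopological.Build stone hat_cover hat_join.

Lemma hat_open (a : B) : open (hat a).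
Proof.
exists [set hat a]; first by move=> _ ->; exists a.
by rewrite bigcup_set1.
Qed.

Lemma hat0 : hat (\bot)%O = set0.
Proof.
by apply/seteqP; split=> // F; rewrite /hat /=; case: (svalP F).
Qed.

Lemma hatI (a b : B) : hat (Order.meet a b) = hat a `&` hat b.
Proof.
apply/seteqP; split=> F; rewrite /hat /=; case: (svalP F) => _ _ up FI _.
  by move=> Fab; split; apply: up Fab _; rewrite ?leIl ?leIr.
by case; exact: FI.
Qed.

Lemma hatC (a : B) : hat (Order.compl a) = ~` hat a.
Proof.
apply/seteqP; split=> F; rewrite /hat /=; case: (svalP F) => _ F0 _ FI FC.
  by move=> FCa Fa; apply: F0; rewrite -(meetxC a); exact: FI.
by case: (FC a).
Qed.

Lemma hatU (a b : B) : hat (Order.join a b) = hat a `|` hat b.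
Proof.
by rewrite -[Order.join a b]complK complU hatC hatI !hatC setCI !setCK.
Qed.

Lemma hat_clopen (a : B) : clopen (hat a).
Proof.
split; first exact: hat_open.
by rewrite -[hat a]setCK -hatC; apply: open_closedC; exact: hat_open.
Qed.

End Stone.
Arguments stone {d} B.

(* The library's [{tblmorphism _ -> _}] only preserves [\bot] and [\top]. *)
Definition boolean_morphism d d' (B : ctbDistrLatticeType d)
    (C : ctbDistrLatticeType d') (j : B -> C) : Prop :=
  [/\ j (\bot)%O = (\bot)%O, j (\top)%O = (\top)%O,
      {morph j : a b / Order.meet a b},
      {morph j : a b / Order.join a b} &
      {morph j : a / Order.compl a}].

Section StoneMap.
Context (d d' : Order.disp_t).
Context (B : ctbDistrLatticeType d) (C : ctbDistrLatticeType d').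
Context (j : B -> C) (jP : boolean_morphism j).

Lemma preimage_ultrafilter (F : stone C) : is_ultrafilter (j @^-1` sval F).
Proof.
case: jP => j0 j1 jI _ jC; case: (svalP F) => F1 F0 up FI FC; split=> /=.
- by rewrite j1.
- by rewrite j0.
- by move=> a b ja ab; apply: up ja _; rewrite -(meet_idPl ab) jI leIr.
- by move=> a b ja jb; rewrite jI; exact: FI.
- by move=> a; rewrite jC; exact: FC.
Qed.

Definition stone_map (F : stone C) : stone B :=
  exist _ (j @^-1` sval F) (preimage_ultrafilter F).

Lemma stone_map_hat (a : B) : stone_map @^-1` hat a = hat (j a).
Proof. by []. Qed.

Lemma stone_map_continuous : continuous stone_map.
Proof.
apply/continuousP => U [D DB <-]; rewrite preimage_bigcup.
by apply: bigcup_open => A /DB[a _ <-]; rewrite stone_map_hat; exact: hat_open.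
Qed.

End StoneMap.

Section StoneCech.
Context (Y : Type).

Definition beta : topologicalType := stone (set Y).

Lemma principal_ultrafilter (y : Y) : is_ultrafilter [set P : set Y | P y].
Proof.
split=> //=; first by move=> P Q Py /subsetPset; exact.
by move=> P; case: (pselect (P y)); [left|right].
Qed.

Definition principal (y : Y) : beta :=
  exist _ [set P : set Y | P y] (principal_ultrafilter y).

(* The subset of [Y] corresponding to a clopen [U] of [beta Y]; see [hat_trace]. *)
Definition trace (U : set beta) : set Y := principal @^-1` U.

Lemma hat_trace (U : set beta) : clopen U -> hat (trace U) = U.
Proof.
have key (V : set beta) (F : beta) : open V -> V F -> sval F (trace V).
  move=> [D DB <-] [A DA FA]; have [P _ PA] := DB _ DA.
  case: (svalP F) => _ _ up _ _; apply: (up P); first by move: FA; rewrite -PA.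
  by apply/subsetPset => y Py; exists A => //; rewrite -PA.
move=> [oU cU]; apply/seteqP; split=> F; rewrite /hat /=; last exact: key.
move=> FU; apply: contrapT => nUF.
have : sval F (trace (~` U)) by apply: key => //; exact: closed_openC.
case: (svalP F) => _ F0 _ FI _ FnU; apply: F0.
by rewrite -(meetxC (trace U)); exact: FI.
Qed.

Lemma trace_hat (P : set Y) : trace (hat P) = P.
Proof. by []. Qed.

End StoneCech.

Section Measures.
Context (d : Order.disp_t) (B : ctbDistrLatticeType d) (S : finPzSemiRingType).

Definition is_measure (mu : B -> S) : Prop :=
  mu (\bot)%O = 0 /\
  forall a b, mu (Order.join a b) + mu (Order.meet a b) = mu a + mu b.

(* [measures B S] is M(X, S) for [X := stone B], i.e. a subspace of the product
   of copies of the discrete space [S]. *)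
Definition measures : topologicalType :=
  set_type [set mu : {ptws B -> discrete_topology S} | is_measure mu].

Definition mfun (mu : measures) : B -> S := set_val mu.

Lemma mfunP (mu : measures) : is_measure (mfun mu).
Proof. by have /set_mem := valP mu. Qed.

Definition mk_measure (mu : B -> S) (muP : is_measure mu) : measures :=
  exist _ (mu : {ptws B -> discrete_topology S}) (mem_set muP).

End Measures.
Arguments measures {d} B S.

Section Pushforward.
Context (Y : Type) (d : Order.disp_t) (B : ctbDistrLatticeType d).
Context (S : finPzSemiRingType).
Context (f : beta Y -> stone B) (mu : measures (set Y) S).

Definition pushforward_fun (a : B) : S := mfun mu (trace (f @^-1` hat a)).

Lemma pushforwardP : is_measure pushforward_fun.
Proof.
have [mu0 muU] := mfunP mu; split=> [|a b]; rewrite /pushforward_fun.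
  by rewrite hat0 preimage_set0; exact: mu0.
by rewrite hatU hatI preimage_setU preimage_setI; exact: muU.
Qed.

Definition pushforward : measures B S := mk_measure pushforwardP.

End Pushforward.
Arguments pushforward {Y d B S} f mu.

Section Integral.
Context (Y : choiceType) (S : finPzSemiRingType).

Definition fin_supp : Type := {g : Y -> S | finite_set [set y | g y != 0]}.

Definition integral_fun (g : fin_supp) (P : set Y) : S :=
  \sum_(y \in P) sval g y.

Lemma integralP (g : fin_supp) : is_measure (integral_fun g).
Proof.
case: g => g gfin; set r : seq Y := fset_set [set y | g y != 0].
have sumE (P : set Y) : \sum_(y \in P) g y =
    \sum_(y <- r) if y \in P then g y else 0.
  rewrite -big_mkcond [RHS]bigfs ?fset_uniq ?set_mem_set // => y _.
  by rewrite /r in_fset_set // notin_setE /= => /negP; rewrite negbK => /eqP.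
split=> [|P Q]; rewrite /integral_fun /= ?fsbig_set0 //.
rewrite !sumE -!big_split /=; apply: eq_bigr => y _.
have -> : Order.join P Q = P `|` Q by [].
have -> : Order.meet P Q = P `&` Q by [].
by rewrite in_setU in_setI; case: (y \in P); case: (y \in Q);
  rewrite /= ?addr0 ?add0r.
Qed.

Definition integral (g : fin_supp) : measures (set Y) S :=
  mk_measure (integralP g).

End Integral.

Section Generated.
Context (d : Order.disp_t) (C : ctbDistrLatticeType d).

Definition boolean_subalgebra (G : set C) : Prop :=
  [/\ G (\bot)%O, G (\top)%O,
      (forall a b, G a -> G b -> G (Order.meet a b)),
      (forall a b, G a -> G b -> G (Order.join a b)) &
      (forall a, G a -> G (Order.compl a))].

Lemma boolean_subalgebra_smallest (E : set C) :
  boolean_subalgebra (smallest boolean_subalgebra E).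
Proof.
split=> [G [[]]|G [[]]|a b Ea Eb G GP|a b Ea Eb G GP|a Ea G GP] //.
- by case: (GP) => -[_ _ GI _ _] _; apply: GI; [exact: Ea|exact: Eb].
- by case: (GP) => -[_ _ _ GU _] _; apply: GU; [exact: Ea|exact: Eb].
- by case: (GP) => -[_ _ _ _ GC] _; apply: GC; exact: Ea.
Qed.

Section GeneratedAlgebra.
Context (E : set C).

Definition generated : Type := set_type (smallest boolean_subalgebra E).

HB.instance Definition _ := SubChoice.on generated.

Lemma gen0 : (\bot)%O \in smallest boolean_subalgebra E.
Proof. by apply/mem_set; case: (boolean_subalgebra_smallest E). Qed.

Lemma gen1 : (\top)%O \in smallest boolean_subalgebra E.
Proof. by apply/mem_set; case: (boolean_subalgebra_smallest E). Qed.

Lemma genI : meet_closed (mem (smallest boolean_subalgebra E)).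
Proof.
move=> a b /set_mem Ea /set_mem Eb; apply/mem_set.
by case: (boolean_subalgebra_smallest E) => _ _ + _ _; apply.
Qed.

Lemma genU : join_closed (mem (smallest boolean_subalgebra E)).
Proof.
move=> a b /set_mem Ea /set_mem Eb; apply/mem_set.
by case: (boolean_subalgebra_smallest E) => _ _ _ + _; apply.
Qed.

HB.instance Definition _ :=
  Order.SubChoice_isTBSubLattice.Build d C _ d generated genI genU gen0 gen1.

Lemma gen_meetUl : @left_distributive generated generated
  (@Order.meet _ generated) (@Order.join _ generated).
Proof.
by move=> a b c; apply: val_inj; exact: meetUl.
Qed.

HB.instance Definition _ :=
  Order.Lattice_Meet_isDistrLattice.Build d generated gen_meetUl.

Lemma gen_compl_subproof (a : generated) :
  Order.compl (val a) \in smallest boolean_subalgebra E.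
Proof.
apply/mem_set; case: (boolean_subalgebra_smallest E) => _ _ _ _; apply.
exact/set_mem/(valP a).
Qed.

Definition gen_compl (a : generated) : generated :=
  exist _ (Order.compl (val a)) (gen_compl_subproof a).

Lemma gen_joinxC (a : generated) : Order.join a (gen_compl a) = (\top)%O.
Proof. by apply: val_inj; exact: joinxC. Qed.

Lemma gen_meetxC (a : generated) : Order.meet a (gen_compl a) = (\bot)%O.
Proof. by apply: val_inj; exact: meetxC. Qed.

HB.instance Definition _ :=
  Order.TBDistrLattice_hasComplement.Build d generated gen_joinxC gen_meetxC.

End GeneratedAlgebra.

End Generated.

Section Counting.
Context (s : signature) (T : theory s) (n : nat) (i : 'I_n).
Context (S : finPzSemiRingType).

(* The function [1^i_q] on the pairs themselves: [drop_var i p = q] says that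
   [p] and [q] have the same structure and that their assignments agree on all
   [v_l], [l <> i]. *)
Definition pair_indicator (q : fin_pair T (others i))
    (p : {classic (fin_pair T 'I_n)}) : S :=
  if `[< drop_var i p = q >] then 1 else 0.

(* On classes, the value is the sum over the pairs in the class: distinct
   elements [a] and [b] of [A] may give identified pairs [(A, al + (v_i |-> a))]
   and [(A, al + (v_i |-> b))], and each of them contributes [1], so that the
   integral of this function counts elements of [A].  (Over the empty signature,
   contributing [1] once per class would give total mass [1] for all nonempty
   sets when [n = 1], whereas [witnesses] of the top element is their
   cardinality.)  Since elementarily equivalent finite structures are
   isomorphic, this does not
   depend on the representative of [x]. *)
Definition indicator_fun (x : Fin T (others i)) (y : Fin T 'I_n) : S :=
  \sum_(p \in [set p : {classic (fin_pair T 'I_n)} | cls p = y])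
    pair_indicator (repr x) p.

Lemma indicator_finite (x : Fin T (others i)) :
  finite_set [set y | indicator_fun x y != 0].
Proof.
apply: (@sub_finite_set _ _ ((fun a => cls (extend a)) @` [set: dom (repr x)])).
  move=> y /=; apply: contra_neqP => nex; apply: fsbig1 => p /= py.
  rewrite /pair_indicator; case: asboolP => // pq; have [a pa] := drop_var_eq pq.
  by case: nex; exists a => //; rewrite -pa.
exact/finite_image/carrier_finite.
Qed.

Definition indicator (x : Fin T (others i)) : fin_supp (Fin T 'I_n) S :=
  exist _ (indicator_fun x) (indicator_finite x).

Context (d : Order.disp_t) (B : ctbDistrLatticeType d).
Context (j : B -> set (Fin T 'I_n)).

Definition witnesses (phi : B) (q : fin_pair T (others i)) : nat :=
  #|` fset_set [set a : {classic (dom q)} | j phi (cls (@extend _ _ _ _ q a))]|.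

Definition counting_set (phi : B) (k : S) : set (Fin T (others i)) :=
  [set x | (witnesses phi (repr x))%:R = k].

Definition B_exists :=
  generated [set P | exists phi k, P = counting_set phi k].

End Counting.

Definition homeomorphic (X Y : topologicalType) : Prop :=
  exists (f : X -> Y) (g : Y -> X),
    [/\ continuous f, continuous g, cancel f g & cancel g f].

Definition continuous_extension (Y : Type) (Z : topologicalType) (h : Y -> Z)
    (R : beta Y -> Z) : Prop :=
  continuous R /\ forall y, R (principal y) = h y.

(* Main.v *)
(* A map [h] from a discrete set [Y] to M(X, S) extends to [beta Y] by sending
   an ultrafilter [F] to the measure whose value at [phi] is the only [k] with
   [{y | h y phi = k}] in [F]; such a [k] exists because [S] is finite.  Hence
   two ultrafilters have the same image iff they agree on these level sets,
   equivalently on the Boolean algebra that these generate, and every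
   ultrafilter of this subalgebra extends to one of P(Y).  So the image of the
   extension is the Stone space of the subalgebra.  In the theorem the measure
   attached to [(A, al)] takes at [phi] the value [m * 1], [m] being the number
   of witnesses of [phi] in [A], so the level sets are the generators of
   [B_exists]. *)

Require Import Defs.
From HB Require Import structures.
From mathcomp Require Import all_boot all_order all_algebra finmap.
From mathcomp Require Import all_classical topology.

Local Open Scope classical_set_scope.

Set Implicit Arguments.
Unset Strict Implicit.
Unset Printing Implicit Defensive.

(** * Topology of the space of measures *)

Section MeasureSpace.
Context (d : Order.disp_t) (B : ctbDistrLatticeType d) (S : finPzSemiRingType).

Lemma mfun_inj : injective (@mfun d B S).
Proof. by move=> mu nu munu; apply: val_inj. Qed.

Lemma mfun_continuous (phi : B) :
  continuous (fun mu : measures B S => mfun mu phi : discrete_topology S).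
Proof.
move=> mu; apply: (@continuous_comp _ {ptws B -> discrete_topology S} _
  (set_val : measures B S -> _) (fun u => u phi)).
  exact: (@initial_continuous _ {ptws B -> discrete_topology S}).
exact: (@proj_continuous B (fun=> discrete_topology S) phi).
Qed.

Lemma clopen_mfun (phi : B) (k : S) :
  clopen [set mu : measures B S | mfun mu phi = k].
Proof.
have -> : [set mu : measures B S | mfun mu phi = k] =
    (fun mu : measures B S => mfun mu phi : discrete_topology S) @^-1` [set k].
  by [].
apply: preimage_clopen; last first.
  by move=> mu; apply: mfun_continuous.
by split; [exact: discrete_open | exact: discrete_closed].
Qed.

(** The topology on measures is induced from the product, which is the supremum of those induced by
    the evaluations. As [S] is discrete, a neighbourhood of [mfun (w x) phi] need only contain that
    value. *)
Lemma continuous_measures (X : topologicalType) (w : X -> measures B S) :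
  (forall phi k, open [set x | mfun (w x) phi = k]) -> continuous w.
Proof.
move=> wo x.
have wx : (set_val \o w : X -> {ptws B -> discrete_topology S}) @ x -->
    set_val (w x).
  apply/cvg_sup => phi U [_ [[V _ <-]] Vwx VU].
  apply: (filterS (P := [set z | mfun (w z) phi = mfun (w x) phi])).
    by move=> z /= zx; apply: VU => /=; move: Vwx; rewrite /= -/(mfun _ _) -zx.
  by apply: open_nbhs_nbhs; split.
move=> U [_ [[V Vo <-] Vwx VU]]; apply: filterS VU _.
by apply: wx; apply: open_nbhs_nbhs.
Qed.

End MeasureSpace.

(** * Extending ultrafilters from a subalgebra to the power set *)

Section UltrafilterExtension.
Context (Y : Type).

Lemma ultrafilter_nonempty (F : beta Y) (P : set Y) : sval F P -> P !=set0.
Proof.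
case: (svalP F) => _ F0 _ _ _ FP; apply/set0P/eqP => P0.
by apply: F0; rewrite -[(\bot)%O]/(@set0 Y) -P0.
Qed.

(** The upward closure of [U] among subsets of [Y] is a proper filter, so some ultrafilter [G]
    refines it. [G] restricts to exactly [U]: if [a] is not in [U], its complement is, and so lies
    in [G]. *)
Lemma beta_of_subalgebra (E : set (set Y)) (U : stone (generated E)) :
  exists F : beta Y, forall a : generated E, sval F (val a) <-> sval U a.
Proof.
case: (svalP U) => U1 U0 up UI UC.
pose F0 := [set P | exists2 a, sval U a & val a `<=` P].
have F0P : ProperFilter F0.
  split.
    move=> [a Ua a0]; apply: U0; suff <- : a = (\bot)%O by [].
    by apply: val_inj; apply/seteqP; split => // y /a0.
  split=> [|P Q [a Ua aP] [b Ub bQ]|P Q PQ [a Ua aP]].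
  - by exists (\top)%O.
  - exists (Order.meet a b); first exact: UI.
    by move=> y [ya yb]; split; [exact: aP | exact: bQ].
  - by exists a => //; exact: subset_trans PQ.
have [G [GU F0G]] := ultraFilterLemma F0P.
have GP : @is_ultrafilter _ (set Y) G.
  split.
  - exact: filterT.
  - exact: filter_not_empty.
  - by move=> P Q GP /subsetPset PQ; apply: filterS GP.
  - by move=> P Q GP GQ; apply: filterI.
  - by move=> P; apply: in_ultra_setVsetC.
exists (exist _ G GP) => a; split=> [Ga|Ua]; last by apply: F0G; exists a.
have [//|UnA] := UC a.
have GnA : G (val (Order.compl a)) by apply: F0G; exists (Order.compl a).
exfalso; apply: (@filter_not_empty _ G _).
by rewrite -(setICr (val a)); apply: filterI.
Qed.

End UltrafilterExtension.

(** * The continuous extension and its image *)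

Section Extension.
Context (Y : Type) (d : Order.disp_t) (B : ctbDistrLatticeType d).
Context (S : finPzSemiRingType) (h : Y -> measures B S).

Definition level (phi : B) (k : S) : set Y := [set y | mfun (h y) phi = k].

(** Otherwise [F] contains the complements of all level sets of [phi]; since [S] is finite, it
    contains their intersection, which is empty. *)
Lemma level_exists (F : beta Y) (phi : B) : exists k, sval F (level phi k).
Proof.
case: (svalP F) => F1 F0 up FI FC; apply: contrapT => /forallNP nF.
have /(_ (enum S)) Fs (s : seq S) : sval F [set y | mfun (h y) phi \notin s].
  elim: s => [|k s IHs]; first by apply: up F1 _; apply/subsetPset.
  have [/nF//|Fk] := FC (level phi k).
  apply: up (FI _ _ IHs Fk) _; apply/subsetPset => y [/= ys yk].
  by rewrite in_cons negb_or ys andbT; apply/eqP.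
by have [y /=] := ultrafilter_nonempty Fs; rewrite mem_enum.
Qed.

Definition limit_fun (F : beta Y) (phi : B) : S :=
  projT1 (cid (level_exists F phi)).

Lemma limit_level (F : beta Y) (phi : B) : sval F (level phi (limit_fun F phi)).
Proof. by rewrite /limit_fun; case: cid. Qed.

Lemma limit_funE (F : beta Y) (phi : B) (k : S) :
  limit_fun F phi = k <-> sval F (level phi k).
Proof.
split=> [<-|Fk]; first exact: limit_level.
case: (svalP F) => _ _ _ FI _.
by have [y [/= <- ->]] := ultrafilter_nonempty (FI _ _ (limit_level F phi) Fk).
Qed.

(** Each measure identity involves finitely many values. The corresponding level sets lie in [F] and
    so share a point [y], where the identity holds because [h y] is a measure. *)
Lemma limit_funP (F : beta Y) : is_measure (limit_fun F).
Proof.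
case: (svalP F) => F1 _ up FI _; split=> [|a b].
  apply/limit_funE; apply: up F1 _; apply/subsetPset => y _.
  by case: (mfunP (h y)).
have [y [[/= <- <-] [/= <- <-]]] := ultrafilter_nonempty
  (FI _ _ (FI _ _ (limit_level F (Order.join a b))
                  (limit_level F (Order.meet a b)))
          (FI _ _ (limit_level F a) (limit_level F b))).
by case: (mfunP (h y)).
Qed.

Definition limit (F : beta Y) : measures B S := mk_measure (limit_funP F).

Lemma limit_extension : continuous_extension h limit.
Proof.
split=> [|y].
  apply: continuous_measures => phi k.
  have -> : [set F | mfun (limit F) phi = k] = hat (level phi k).
    by apply/seteqP; split=> F /limit_funE.
  exact: hat_open.
by apply: mfun_inj; apply: funext => phi; apply/limit_funE.
Qed.

(** The preimage under [R] of a clopen condition on measures is clopen in [beta Y], hence determined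
    by its trace on principal ultrafilters, where [R] agrees with [h]. This yields uniqueness. *)
Lemma continuous_extensionE (R : beta Y -> measures B S) :
  continuous_extension h R -> forall F phi k,
  mfun (R F) phi = k <-> sval F (level phi k).
Proof.
move=> [Rc Rh] F phi k.
have /hat_trace : clopen (R @^-1` [set mu | mfun mu phi = k]).
  by apply: preimage_clopen; [exact: clopen_mfun | move=> G; exact: Rc].
have -> : trace (R @^-1` [set mu | mfun mu phi = k]) = level phi k.
  by apply/seteqP; split=> y; rewrite /trace /= Rh.
by move=> /(congr1 (@^~ F)) /= <-.
Qed.

Lemma unique_limit : unique (continuous_extension h) limit.
Proof.
split; first exact: limit_extension.
move=> R /continuous_extensionE RE; apply: funext => F; apply: mfun_inj.
by apply: funext => phi; apply/esym/RE; exact: limit_level.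
Qed.

Context (E : set (set Y)) (EP : E = [set P | exists phi k, P = level phi k]).

Lemma level_generated (phi : B) (k : S) :
  level phi k \in smallest (@boolean_subalgebra _ (set Y)) E.
Proof.
by apply: mem_set; apply: sub_gen_smallest; rewrite EP; exists phi, k.
Qed.

Definition generator (phi : B) (k : S) : generated E :=
  exist (fun P => P \in smallest (@boolean_subalgebra _ (set Y)) E)
    (level phi k) (level_generated phi k).

Lemma limit_eqP (F G : beta Y) :
  (forall a : generated E, sval F (val a) <-> sval G (val a)) ->
  limit F = limit G.
Proof.
move=> FG; apply: mfun_inj; apply: funext => phi; apply/limit_funE.
by apply: (proj2 (FG (generator phi (limit_fun G phi)))); exact: limit_level.
Qed.

(* The sets [P] for which membership [P \in F] is decided by a clopen condition
   on [limit F] form a Boolean subalgebra containing the level sets. *)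
Lemma generated_clopen (a : generated E) :
  exists2 W : set (measures B S), clopen W &
    forall F, sval F (val a) <-> W (limit F).
Proof.
have /set_mem := valP a; move: (val a) => {a}; apply: smallest_sub; last first.
  rewrite EP => _ [phi [k ->]]; exists [set mu | mfun mu phi = k].
    exact: clopen_mfun.
  by move=> F; rewrite -limit_funE.
split.
- exists set0; first exact: clopen0.
  by move=> F; split=> //; case: (svalP F).
- exists setT; first exact: clopenT.
  by move=> F; split=> // _; case: (svalP F).
- move=> P Q [W Wc WP] [V Vc VQ]; exists (W `&` V); first exact: clopenI.
  by move=> F; rewrite -[sval F _]/(hat _ _) hatI; split=> -[/WP ? /VQ ?].
- move=> P Q [W Wc WP] [V Vc VQ]; exists (W `|` V); first exact: clopenU.
  move=> F; rewrite -[sval F _]/(hat _ _) hatU.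
  by split=> -[/WP ?|/VQ ?]; [left|right|left|right].
- move=> P [W Wc WP]; exists (~` W); first exact: clopenC.
  by move=> F; rewrite -[sval F _]/(hat _ _) hatC; split=> /= nP /WP.
Qed.

Lemma val_generated_morphism : boolean_morphism (val : generated E -> set Y).
Proof. by []. Qed.

Lemma range_limit_homeomorphic :
  homeomorphic (range limit) (stone (generated E)).
Proof.
pose res := stone_map val_generated_morphism.
have /choice [lift liftP] (mu : range limit) : exists F, limit F = set_val mu.
  by have /set_mem [F _ Fmu] := valP mu; exists F.
have /choice [ext extP] := @beta_of_subalgebra Y E.
have limit_range F : limit F \in range limit by apply/mem_set; exists F.
pose back U : range limit := exist _ (limit (ext U)) (limit_range (ext U)).
(* The choice of [lift] is harmless: ultrafilters with the same limit agree on the subalgebra. *)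
have agree F G : limit F = limit G ->
    forall a : generated E, sval F (val a) <-> sval G (val a).
  by move=> FG a; have [W _ WE] := generated_clopen a; rewrite !WE FG.
have stone_inj (U V : stone (generated E)) :
    (forall a, sval U a <-> sval V a) -> U = V.
  move=> UV; apply: eq_sig_hprop => [F ? ?|]; first exact: Prop_irrelevance.
  by apply/seteqP; split=> a /UV.
exists (res \o lift), back; split.
- apply/continuousP => U [D DB <-]; rewrite preimage_bigcup.
  apply: bigcup_open => A /DB [a _ <-].
  have [W [Wo _] WE] := generated_clopen a.
  have -> : (res \o lift) @^-1` hat a = set_val @^-1` W.
    by apply/seteqP; split=> mu /=; rewrite /hat /= WE liftP.
  by exists W.
- move=> U.
  (* [ext] is an arbitrary choice and need not be continuous, but [limit (ext V)] depends only on
     which generators lie in [V]. *)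
  have bc : continuous (fun V => limit (ext V)).
    apply: continuous_measures => phi k.
    have -> : [set V | mfun (limit (ext V)) phi = k] = hat (generator phi k).
      by apply/seteqP; split=> V; rewrite /hat /= limit_funE -extP.
    exact: hat_open.
  move=> N [_ [[W Wo <-] WU WN]]; rewrite nbhs_filterE /fmap /=.
  apply: (@filterS _ (nbhs U) _ (back @^-1` (set_val @^-1` W)) _
    (fun V => WN (back V))).
  by apply: (bc U W); apply: open_nbhs_nbhs.
- move=> mu; apply: val_inj; rewrite /= -[RHS]liftP; apply: limit_eqP => a.
  exact: extP.
- move=> U; apply: stone_inj => a /=; rewrite -extP; apply: agree.
  exact: liftP.
Qed.

End Extension.

(** * Counting witnesses by integrating indicators *)

Local Open Scope ring_scope.

(** [P] and the fibers may be infinite; finite support of [f] turns all sums into sums over [r] and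
    its image under [g], which can be exchanged. *)
Lemma fsbig_fibers (I J : choiceType) (V : nmodType) (g : I -> J) (f : I -> V)
    (P : set J) : finite_set [set x | f x != 0] ->
  \sum_(y \in P) \sum_(x \in [set x | g x = y]) f x =
  \sum_(x \in g @^-1` P) f x.
Proof.
move=> ffin; set r : seq I := fset_set [set x | f x != 0].
have f0 x : x \notin r -> f x = 0.
  by rewrite in_fset_set // notin_setE /= => /negP; rewrite negbK => /eqP.
have sumE (Q : set I) : \sum_(x \in Q) f x = \sum_(x <- r | x \in Q) f x.
  by rewrite [RHS]bigfs ?fset_uniq ?set_mem_set // => x _; exact: f0.
under eq_fsbigr do rewrite sumE.
transitivity (\sum_(y <- undup (map g r) | y \in P)
    \sum_(x <- r | x \in [set x | g x = y]) f x).
  rewrite [RHS]bigfs ?undup_uniq ?set_mem_set // => y _.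
  rewrite mem_undup => /mapP nyr; rewrite big_seq_cond big1 // => x.
  by case/andP=> xr /set_mem /= gxy; case: nyr; exists x.
rewrite sumE (exchange_big_dep xpredT) //= [RHS]big_mkcond.
apply: eq_big_seq => x xr; rewrite -[x \in _ @^-1` _]/(g x \in P).
rewrite (eq_bigl (fun y => (y == g x) && (g x \in P))) => [|y]; last first.
  have -> : (x \in [set x | g x = y]) = (y == g x).
    by apply/idP/eqP => [/set_mem/esym|->]; last exact: mem_set.
  by have [->|_] := eqVneq y (g x); rewrite ?andbT ?andbF.
rewrite big_mkcondr /= -big_filter filter_pred1_uniq ?undup_uniq //.
  by rewrite big_seq1.
by rewrite mem_undup map_f.
Qed.

Section Counting.
Context (s : signature) (T : theory s) (n : nat) (i : 'I_n).
Context (S : finPzSemiRingType).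

Lemma extend_inj (q : fin_pair T (others i)) : injective (@extend s T n i q).
Proof.
move=> a b /(congr1 (fun p => existT (fun D : fin_model T => 'I_n -> D)
  (dom p) (@asg _ _ _ p))) /= ab.
(* The carriers are equal by a proof of [dom q = dom q]; replacing it by [erefl] removes the
   transport. At [i], [insub] fails and the assignments return [a] and [b]. *)
have := projT2_eq ab; rewrite (Prop_irrelevance (projT1_eq ab) erefl) /=.
by move=> /(congr1 (@^~ i)); rewrite insubF ?eqxx.
Qed.

Lemma drop_extend (q : fin_pair T (others i)) (a : dom q) :
  drop_var i (extend a) = q.
Proof.
case: q a => D al a; congr FinPair; apply: funext => l /=.
by rewrite valK.
Qed.

(** Ungrouping the classes leaves a sum over pairs. Those of indicator [1] are the extensions of
    [repr x], one for each element by [extend_inj], so elements are counted even when their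
    extensions are identified. *)
Lemma sum_indicator (x : Fin T (others i)) (P : set (Fin T 'I_n)) :
  \sum_(y \in P) indicator_fun S x y =
  #|` fset_set [set a : {classic (dom (repr x))} | P (cls (extend a))]|%:R.
Proof.
set q := repr x.
pose ext (a : {classic (dom q)}) : {classic (fin_pair T 'I_n)} := extend a.
have finA (A : set {classic (dom q)}) : finite_set A.
  exact: sub_finite_set (@subsetT _ _) (carrier_finite (dom q)).
have indE p : pair_indicator S q p = if p \in range ext then 1 else 0.
  rewrite /pair_indicator; case: asboolP => [pq|npq].
    by rewrite mem_set //; have [a ->] := drop_var_eq pq; exists a.
  rewrite memNset // => -[a _ ap]; apply: npq; rewrite -ap.
  exact: drop_extend.
rewrite (fsbig_fibers (fun p : {classic (fin_pair T 'I_n)} => cls p));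
  last first.
  apply: (sub_finite_set (B := range ext)); last exact/finite_image/finA.
  by move=> p /=; rewrite indE; case: ifP => [/set_mem//|]; rewrite eqxx.
under eq_fsbigr do rewrite indE.
rewrite -fsbig_mkcondr.
set W := [set a | _].
have -> : (fun p : {classic (fin_pair T 'I_n)} => cls p) @^-1` P `&` range ext =
    ext @` W.
  apply/seteqP; split=> [p [/= Pp [a _ ap]]|_ [a Wa <-]]; last first.
    by split=> //; exists a.
  by exists a => //; rewrite /W /= -[extend a]/(ext a) ap.
rewrite fsbig_image; last by move=> a b _ _; exact: extend_inj.
by rewrite fsbig_finite // big_const_seq count_predT -Monoid.iteropE.
Qed.

Context (d : Order.disp_t) (B : ctbDistrLatticeType d).
Context (j : B -> set (Fin T 'I_n)) (jP : boolean_morphism j).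

(** By computation, the trace of the preimage of [hat phi] under [stone_map jP] is [j phi]. *)
Lemma mfun_pushforward_indicator (x : Fin T (others i)) (phi : B) :
  mfun (pushforward (stone_map jP) (integral (indicator S x))) phi =
  (witnesses j phi (repr x))%:R.
Proof. exact: sum_indicator. Qed.

End Counting.

Theorem theorem3p4 (s : signature) (T : theory s) (n : nat) (i : 'I_n)
    (S : finPzSemiRingType) (d : Order.disp_t) (B : ctbDistrLatticeType d)
    (j : B -> set (Fin T 'I_n)) (jP : boolean_morphism j)
    (j_inj : injective j) :
  exists R : beta (Fin T (others i)) -> measures B S,
    unique
      (continuous_extension (fun x : Fin T (others i) =>
         pushforward (stone_map jP) (integral (indicator S x))))
      R
    /\ homeomorphic (range R) (stone (B_exists i S j)).
Proof.
exists (limit (fun x : Fin T (others i) =>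
  pushforward (stone_map jP) (integral (indicator S x)))).
split; first exact: unique_limit.
apply: range_limit_homeomorphic; congr mkset; apply: funext => P.
congr ex; apply: funext => phi; congr ex; apply: funext => k; congr eq.
apply/seteqP; split=> x;
  by rewrite /level /counting_set /= mfun_pushforward_indicator.
Qed.
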